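(* Let $\mathcal{L}$ be a non-trivial finite atomistic lattice. Let $A_1,\dots,A_L \subseteq \mathrm{At}(\mathcal{L})$ be any subsets with $A_1 \cup \cdots \cup A_L = \mathrm{At}(\mathcal{L})$. For all $x \in \mathcal{L}$ we have $$\mu_{\mathcal{L}}(x) = \sum_{ \substack{(x_1,\dots,x_L) \in \mathcal{L}(A_1) \times \cdots \times \mathcal{L}(A_L) \\ x_1 \vee \cdots \vee x_L=x}} \ \prod_{\ell=1}^L \mu_{A_\ell}(x_\ell).$$
   Context: A lattice is non-trivial if it has more than one element. $\mathrm{At}(\mathcal{L})$ is the set of atoms of $\mathcal{L}$; $\mathcal{L}$ is atomistic if every nonzero element is a join of atoms (no gradedness is assumed). For a possibly empty $A\subseteq\mathrm{At}(\mathcal{L})$, $\mathcal{L}(A)$ is the set of elements of $\mathcal{L}$ that are joins (in $\mathcal{L}$) of some elements of $A$, together with $0\in\mathcal{L}$, with the order induced by $\mathcal{L}$ (it is a lattice). $\mu_{\mathcal{L}}$ and $\mu_A$ denote the Möbius functions of $\mathcal{L}$ and $\mathcal{L}(A)$, and $\mu_{\mathcal{L}}(x)=\mu_{\mathcal{L}}(0,x)$, $\mu_A(x)=\mu_A(0,x)$. Joins $\vee$ are taken in $\mathcal{L}$. *)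

(* Defs.v *)
From HB Require Import structures.
From mathcomp Require Import all_boot all_order all_algebra.

Set Implicit Arguments.
Unset Strict Implicit.
Unset Printing Implicit Defensive.

Import Order.TTheory GRing.Theory.

Local Open Scope order_scope.

Section Mobius.
Context {d : Order.disp_t} {P : finPOrderType d}.

(* The usual recursion, with [k] bounding its depth.  Every recursive call
   goes to an element strictly below [y], so [k = #|P|] is enough fuel: see
   [mobius_id], [mobius_lt] and [mobius_nle]. *)
Fixpoint mobius_rec (k : nat) (x y : P) : int :=
  if x == y then 1%R else
  if x < y then
    if k is k'.+1 then (- \sum_(z : P | ((x <= z) && (z < y))%O) mobius_rec k' x z)%R
    else 0%R
  else 0%R.

Definition mobius (x y : P) : int := mobius_rec #|P| x y.

Lemma mobius_id (x : P) : mobius x x = 1%R.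
Proof. by rewrite /mobius; case: #|P| => [|k] /=; rewrite eqxx. Qed.

Lemma mobius_nle (x y : P) : ~~ (x <= y) -> mobius x y = 0%R.
Proof.
rewrite le_eqVlt negb_or /mobius => /andP[/negPf nxy /negPf nlt].
by case: #|P| => [|k] /=; rewrite nxy nlt.
Qed.

Lemma mobius_rec_stable (j k : nat) (x y : P) :
    (#|[set z : P | (z < y)%O]| <= j)%N -> (#|[set z : P | (z < y)%O]| <= k)%N ->
  mobius_rec j x y = mobius_rec k x y.
Proof.
have below_gt0 (u v : P) : u < v -> (0 < #|[set z : P | (z < v)%O]|)%N.
  by move=> uv; apply/card_gt0P; exists u; rewrite inE.
elim: j k y => [|j IHj] [|k] y //= hj hk; case: eqP => // _; case: ifP => // xy.
- by have := below_gt0 _ _ xy; rewrite ltnNge hj.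
- by have := below_gt0 _ _ xy; rewrite ltnNge hk.
congr (- _)%R; apply: eq_bigr => z /andP[_ zy].
have lt_card : (#|[set w : P | (w < z)%O]| < #|[set w : P | (w < y)%O]|)%N.
  apply: proper_card; apply/properP; split.
    by apply/subsetP => w; rewrite !inE => /lt_trans; apply.
  by exists z; rewrite !inE ?ltxx.
by apply: IHj; rewrite -ltnS; [apply: leq_trans hj | apply: leq_trans hk].
Qed.

Lemma mobius_lt (x y : P) : x < y ->
  mobius x y = (- \sum_(z : P | ((x <= z) && (z < y))%O) mobius x z)%R.
Proof.
move=> xy; rewrite /mobius.
rewrite (@mobius_rec_stable #|P| #|P|.+1) /= ?xy ?lt_eqF ?max_card //.
exact: leqW (max_card _).
Qed.

End Mobius.

Section Atomistic.
Context {d : Order.disp_t} {L : finTBLatticeType d}.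

Definition atoms : {set L} :=
  [set a : L | (a != \bot) && [forall b : L, (b < a) ==> (b == \bot)]].

Definition atomistic : Prop :=
  forall x : L, x != \bot ->
    exists2 B : {set L}, B \subset atoms & x = \join_(a in B) a.

Definition join_span (A : {set L}) : {set L} :=
  \bot |: [set \join_(a in B) a | B : {set L} in powerset A].

Definition join_lattice (A : {set L}) : Type := {x : L | x \in join_span A}.

End Atomistic.

Arguments atoms {d} L.
Arguments atomistic {d} L.

Section JoinLattice.
Context {d : Order.disp_t} {L : finTBLatticeType d} (A : {set L}).

HB.instance Definition _ := [isSub of join_lattice A for @proj1_sig _ _].
HB.instance Definition _ := [Finite of join_lattice A by <:].
HB.instance Definition _ :=
  [SubChoice_isSubPOrder of join_lattice A by <: with d].

Definition join_lattice_bot : join_lattice A :=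
  exist _ \bot (setU11 \bot _).

Lemma join_lattice_le0x (x : join_lattice A) : join_lattice_bot <= x.
Proof. by rewrite -Order.le_val le0x. Qed.

HB.instance Definition _ :=
  Order.hasBottom.Build d (join_lattice A) join_lattice_le0x.

End JoinLattice.

(* Main.v *)
Require Import Defs.
From HB Require Import structures.
From mathcomp Require Import all_boot all_order all_algebra.

Set Implicit Arguments.
Unset Strict Implicit.
Unset Printing Implicit Defensive.

Import Order.TTheory GRing.Theory.

Local Open Scope ring_scope.

(** In a finite order with bottom [\bot], the function [mobius \bot] is the
    only [g] whose down-set sums [\sum_(z <= x) g z] equal [1] at [x = \bot] and
    [0] elsewhere ([mobius_bot_unique]).  So it suffices to compute the down-set
    sums of the right-hand side.

    The condition [x_1 \/ ... \/ x_n = z] summed over all [z <= x] becomes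
    [x_1 \/ ... \/ x_n <= x], that is, [x_l <= x] for each [l] separately; the
    sum of products then factors ([prod_sum_dffun]) as the product over [l] of
    the sums of [mobius \bot w] over the [w] in [join_lattice (A l)] with
    [w <= x].  The join [t] of the elements of [A l] below [x] is the largest
    element of [join_lattice (A l)] below [x], so the [l]-th sum is itself a
    down-set sum in [join_lattice (A l)], equal to [1] if [t = \bot] and to [0]
    otherwise ([sum_mobius_join_lattice]).  For [x = \bot] every factor is [1].
    For [x != \bot], atomisticity gives an atom below [x]; it lies in some
    [A l], and the corresponding factor is [0]. *)

Lemma sum_mobius_interval (d : Order.disp_t) (P : finPOrderType d) (x y : P) :
  (x <= y)%O ->
  \sum_(z : P | (x <= z <= y)%O) mobius x z = (x == y)%:R.
Proof.
move=> xy; rewrite (bigD1 y) ?xy ?lexx //=.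
rewrite (eq_bigl (fun z => (x <= z)%O && (z < y)%O)); last first.
  by move=> z; rewrite -andbA [in RHS]lt_neqAle [in RHS](andbC (z != y)).
have [->|nxy] := eqVneq x y; last by rewrite mobius_lt ?lt_neqAle ?nxy // addNr.
rewrite mobius_id big_pred0 ?addr0 // => z.
by apply/negP => /andP[/le_lt_trans h /h]; rewrite ltxx.
Qed.

Lemma sum_mobius_bot (d : Order.disp_t) (P : finBPOrderType d) (y : P) :
  \sum_(z : P | (z <= y)%O) mobius \bot%O z = (y == \bot%O)%:R.
Proof.
rewrite eq_sym -(sum_mobius_interval (le0x y)).
by apply: eq_bigl => z; rewrite le0x.
Qed.

(** Two functions with the same down-set sums agree, by induction along the
    order: once they agree strictly below [x], the sums at [x] force agreement
    at [x]. *)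
Lemma mobius_bot_unique (d : Order.disp_t) (P : finBPOrderType d)
    (g : P -> int) :
    (forall x : P, \sum_(z : P | (z <= x)%O) g z = (x == \bot%O)%:R) ->
  g =1 mobius \bot%O.
Proof.
move=> sum_g x.
have [k] := ubnP #|[set z : P | (z < x)%O]|.
elim: k x => // k IHk x below_x.
have := sum_mobius_bot x; rewrite -sum_g.
rewrite (bigD1 x) //= [in RHS](bigD1 x) //= => eq_sums.
have eq_below : \sum_(z | (z <= x)%O && (z != x)) g z =
                \sum_(z | (z <= x)%O && (z != x)) mobius \bot%O z.
  apply: eq_bigr => z; rewrite andbC -lt_neqAle => zx.
  apply: IHk; rewrite -ltnS; apply: leq_trans below_x; rewrite ltnS.
  apply: proper_card.
  apply/properP; split; last by exists z; rewrite !inE ?ltxx.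
  by apply/subsetP => w; rewrite !inE => /lt_trans; apply.
by apply/esym; move: eq_sums; rewrite eq_below => /addIr.
Qed.

(** The join of the elements of [A] below [x] is the largest element of
    [join_lattice A] below [x]; it is [\bot] exactly when [A] contains no
    nonzero element below [x]. *)
Lemma sum_mobius_join_lattice (d : Order.disp_t) (L : finTBLatticeType d)
    (A : {set L}) (x : L) :
  \sum_(w : join_lattice A | (val w <= x)%O) mobius \bot%O w =
    [forall a in A, (a <= x)%O ==> (a == \bot%O)]%:R.
Proof.
pose B := [set a in A | (a <= x)%O]; pose t : L := (\join_(a in B) a)%O.
have t_in : t \in join_span A.
  apply/setU1P; right; apply/imsetP; exists B => //.
  by rewrite powersetE; apply/subsetP => a; rewrite inE => /andP[].
have tx : (t <= x)%O by apply/joinsP => a; rewrite inE => /andP[].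
have le_t (w : join_lattice A) : (val w <= x)%O = (w <= Sub t t_in)%O.
  rewrite -Order.le_val SubK; apply/idP/idP => [wx|/le_trans]; last exact.
  have /setU1P[->|/imsetP[C]] := valP w; first exact: le0x.
  rewrite powersetE => /subsetP CA w_join; rewrite w_join; apply/joinsP => a aC.
  apply: joins_sup; rewrite inE CA //=; apply: le_trans wx.
  by rewrite w_join; apply: joins_sup.
rewrite (eq_bigl _ _ le_t) sum_mobius_bot -val_eqE /=; congr (_ : bool)%:R.
apply/eqP/forall_inP => [t0 a aA|noA].
  by apply/implyP => ax; rewrite -lex0 -t0; apply: joins_sup; rewrite inE aA.
apply/eqP; rewrite -lex0; apply/joinsP => a; rewrite inE => /andP[aA ax].
by rewrite lex0 (implyP (noA a aA)).
Qed.

(** The dependent form of distributivity is obtained from the one for ordinary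
    finite functions by viewing the values of a dependent family in the common
    type [{i : I & T i}].  Condition [Q] is absorbed into the summand, which
    is set to [0] outside [Q]. *)
Lemma prod_sum_dffun (R : comNzRingType) (I : finType) (T : I -> finType)
    (Q : forall i, pred (T i)) (F : forall i, T i -> R) :
  \prod_i \sum_(j : T i | Q i j) F i j =
    \sum_(f : {dffun forall i, T i} | [forall i, Q i (f i)])
      \prod_i F i (f i).
Proof.
pose G i := [ffun j : T i => if Q i j then F i j else 0].
transitivity (\prod_i \sum_(j : T i) G i j).
  apply: eq_bigr => i _; rewrite big_mkcond; apply: eq_bigr => j _.
  by rewrite ffunE.
under eq_bigr => i _ do rewrite (big_tag (fun i => G i)).
rewrite (bigA_distr_big_dep (fun i => [in tagged_with T i])
                            (fun i => untag 0 (G i))).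
rewrite -(big_fprod 1 _ G) (reindex _ (onW_bij _ (fprod_of_dffun_bij T))) /=.
rewrite [RHS]big_mkcond; apply: eq_bigr => f _.
under eq_bigr => i _ do rewrite fprodE ffunE.
case: ifPn => [/forallP Qf|/forallPn[i /negPf nQ]].
  by apply: eq_bigr => i _; rewrite Qf.
by rewrite (bigD1 i) //= nQ mul0r.
Qed.

Theorem theorem2p4 (d : Order.disp_t) (L : finTBLatticeType d)
    (nontrivial_L : (1 < #|{: L}|)%N) (atomistic_L : atomistic L)
    (n : nat) (A : 'I_n -> {set L})
    (A_atoms : forall l : 'I_n, A l \subset atoms L)
    (A_cover : \bigcup_(l < n) A l = atoms L) (x : L) :
  mobius (\bot)%O x =
    \sum_(y : {dffun forall l : 'I_n, join_lattice (A l)}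
            | (\join_(l < n) val (y l))%O == x)
      \prod_(l < n) mobius (\bot)%O (y l).
Proof.
pose g z : int := \sum_(y : {dffun forall l : 'I_n, join_lattice (A l)}
            | (\join_(l < n) val (y l))%O == z)
      \prod_(l < n) mobius (\bot)%O (y l).
rewrite -/(g x); apply/esym; move: x; apply: mobius_bot_unique => x.
have -> : \sum_(z : L | (z <= x)%O) g z =
    \prod_(l < n) \sum_(w : join_lattice (A l) | (val w <= x)%O)
      mobius \bot%O w.
  rewrite prod_sum_dffun.
  rewrite (partition_big (fun y : {dffun forall l : 'I_n, join_lattice (A l)} =>
             \join_(l < n) val (y l))%O (fun z => z <= x)%O) /=; last first.
    by move=> y /forallP y_le; apply/joinsP => l _; apply: y_le.
  apply: eq_bigr => z zx; apply: eq_bigl => y.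
  apply/idP/andP => [/eqP yz|[]//]; split; last exact/eqP.
  apply/forallP => l; apply: le_trans zx; rewrite -yz.
  exact: (joins_sup (fun l => val (y l))).
under eq_bigr => l _ do rewrite sum_mobius_join_lattice.
have [->|x0] := eqVneq x \bot%O.
  rewrite big1 // => l _.
  rewrite (_ : [forall a in A l, _] = true) //.
  by apply/forall_inP => a _; rewrite lex0 implybb.
have [B /subsetP B_atoms x_join] := atomistic_L x x0.
have [a aB] : exists a, a \in B.
  apply/set0Pn; apply: contra_neq x0 => B0.
  by rewrite x_join B0 big_set0.
have a_atom := B_atoms a aB.
have ax : (a <= x)%O by rewrite x_join; apply: joins_sup.
have a0 : a != \bot%O by move: a_atom; rewrite inE => /andP[].
have /bigcupP[l _ al] : a \in \bigcup_(l < n) A l by rewrite A_cover.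
rewrite (bigD1 l) //= (_ : [forall a in A l, _] = false) ?mul0r //.
by apply/negP => /forall_inP/(_ a al); rewrite ax (negPf a0).
Qed.
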